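(* Let $n,\ell\geq 1$ be integers, let $q_1,q_2:\{1,\ldots,n\}\to\{1,\ldots,\ell\}$ be two length-$n$ level-$\ell$ sequences, and let $Q=[q_1,q_2]$. Let $A_Q$ be the $\ell\times\ell$ matrix whose entry $A_Q(a,b)$ is the number of indices $i\in\{1,\ldots,n\}$ with $q_1(i)=a$ and $q_2(i)=b$. Then the distance between the sequence patterns $\langle q_1\rangle$ and $\langle q_2\rangle$ is $$d(\langle q_1\rangle,\langle q_2\rangle) = n-\max_{\Phi\in S_\ell^2}\operatorname{tr}(P_\Phi A_Q).$$
   Context: Let $N=\{1,\ldots,n\}$ and $L=\{1,\ldots,\ell\}$. A length-$n$ level-$\ell$ sequence is a function $q:N\to L$. The symmetric group $S_\ell$ acts on such sequences by relabeling symbols: $\phi(q)=\phi\circ q$. The sequence pattern $\langle q\rangle$ is the orbit of $q$ under this action. For two sequences $q,p$, the Hamming distance $d(q,p)$ is the number of $i\in N$ with $q(i)\neq p(i)$. For two sequence patterns, $d(t_1,t_2)=\min\{d(q,p): q\in t_1,\ p\in t_2\}$. For $\phi\in S_\ell$ let $P_\phi$ be the $\ell\times\ell$ permutation matrix with $P_\phi(\phi(a),a)=1$ for all $a\in L$ and all other entries $0$. For $\Phi=[\phi_1,\phi_2]\in S_\ell^2=S_\ell\times S_\ell$, put $P_\Phi=P_{\phi_2}^{T}P_{\phi_1}$, so that $\operatorname{tr}(P_\Phi A)=\operatorname{tr}(P_{\phi_1}AP_{\phi_2}^{T})$ is the trace of the matrix obtained from $A$ by permuting rows by $\phi_1$ and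 columns by $\phi_2$. *)

(* Defs.v *)
From HB Require Import structures.
From mathcomp Require Import all_boot all_order all_algebra all_fingroup.

Set Implicit Arguments.
Unset Strict Implicit.
Unset Printing Implicit Defensive.

Import GRing.Theory.

Local Open Scope ring_scope.

(* Length-n level-l sequences; positions and symbols are numbered from 0. *)
Notation lseq n l := {ffun 'I_n -> 'I_l}.

Definition relabel n l (q : lseq n l) (phi : 'S_l) : lseq n l :=
  [ffun i => phi (q i)].

Lemma relabel1 n l (q : lseq n l) : relabel q 1%g = q.
Proof. by apply/ffunP => i; rewrite ffunE perm1. Qed.

Lemma relabelM n l (q : lseq n l) (phi psi : 'S_l) :
  relabel q (phi * psi)%g = relabel (relabel q phi) psi.
Proof. by apply/ffunP => i; rewrite !ffunE permM. Qed.

(* Products of permutations compose from left to right in MathComp, so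
   phi(q) = phi \o q is an action on the right; its orbits are unaffected. *)
Definition relabel_action n l : {action 'S_l &-> lseq n l} :=
  TotalAction (@relabel1 n l) (@relabelM n l).

Definition pattern n l (q : lseq n l) : {set lseq n l} :=
  orbit (relabel_action n l) [set: 'S_l] q.

Definition hamming n l (q p : lseq n l) : nat := #|[set i | q i != p i]|.

(* Starting the minimum at n is harmless: t1 and t2 are nonempty when they are
   patterns, and Hamming distances never exceed n. *)
Definition pattern_dist n l (t1 t2 : {set lseq n l}) : nat :=
  \big[minn/n]_(u in setX t1 t2) hamming u.1 u.2.

(* perm_mx phi has its nonzero entries at (a, phi a), whence the transpose. *)
Definition Pmx l (phi : 'S_l) : 'M[nat]_l := (perm_mx phi)^T.

Lemma PmxE l (phi : 'S_l) (b a : 'I_l) : Pmx phi b a = (b == phi a).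
Proof. by rewrite !mxE eq_sym; case: eqP. Qed.

Definition Pmx2 l (Phi : 'S_l * 'S_l) : 'M[nat]_l :=
  (Pmx Phi.2)^T *m Pmx Phi.1.

Definition Amx n l (q1 q2 : lseq n l) : 'M[nat]_l :=
  \matrix_(a, b) #|[set i | (q1 i == a) && (q2 i == b)]|.

(* Main.v *)
(** The (a, b) entry of P_Phi is 1 exactly when phi1 b = phi2 a, so
    tr (P_Phi A_Q) counts the positions where phi1 o q1 and phi2 o q2 agree.
    The Hamming distance of these two relabelings is therefore
    n - tr (P_Phi A_Q), and all pairs in the product of the two orbits are of
    this form. *)

Require Import Defs.
From mathcomp Require Import all_boot all_order all_algebra all_fingroup.

Local Open Scope ring_scope.

Lemma Pmx2E (l : nat) (Phi : 'S_l * 'S_l) (a b : 'I_l) :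
  Pmx2 Phi a b = (Phi.1 b == Phi.2 a).
Proof.
(* In the sum defining the matrix product, only the middle index [Phi.2 a] contributes. *)
rewrite /Pmx2 mxE (bigD1 (Phi.2 a)) //= big1 => [|c ca].
  by rewrite mxE !PmxE eqxx eq_sym GRing.addr0 GRing.mul1r.
by rewrite mxE PmxE (negPf ca) GRing.mul0r.
Qed.

Lemma mxtrace_agreement (n l : nat) (q1 q2 : {ffun 'I_n -> 'I_l})
    (Phi : 'S_l * 'S_l) :
  \tr (Pmx2 Phi *m Amx q1 q2) = #|[set i | Phi.1 (q1 i) == Phi.2 (q2 i)]|.
Proof.
(* The trace pairs entry (a, b) of P_Phi with entry (b, a) of A_Q, hence positions are classed by
   [(q2 i, q1 i)] in this order. *)
rewrite /mxtrace -sum1_card (partition_big (fun i => (q2 i, q1 i)) predT) //=.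
rewrite -(pair_bigA _ (fun a b => \sum_(i | (i \in [set j | Phi.1 (q1 j) ==
  Phi.2 (q2 j)]) && ((q2 i, q1 i) == (a, b))) 1%N)%N) /=.
apply: eq_bigr => a _; rewrite mxE; apply: eq_bigr => b _.
(* Agreement is constant on each class: all its positions count if [Phi.1 b = Phi.2 a], none
   otherwise. *)
rewrite Pmx2E mxE sum1_card; case: eqP => [ab | nab].
  rewrite GRing.mul1r; apply: eq_card => i; rewrite !inE [RHS]unfold_in /= inE.
  rewrite xpair_eqE andbC.
  by case: eqP => [-> | _]; case: eqP => [-> | _]; rewrite ?ab ?eqxx ?andbF.
rewrite GRing.mul0r; apply/esym/eq_card0 => i; rewrite [LHS]unfold_in /= inE.
by rewrite xpair_eqE; apply/negP => /and3P[/eqP e /eqP e2 /eqP e1];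
  rewrite e1 e2 in e.
Qed.

Lemma hamming_relabel (n l : nat) (q1 q2 : {ffun 'I_n -> 'I_l})
    (Phi : 'S_l * 'S_l) :
  hamming (relabel q1 Phi.1) (relabel q2 Phi.2) =
    (n - \tr (Pmx2 Phi *m Amx q1 q2))%N.
Proof.
rewrite mxtrace_agreement /hamming cardsCs card_ord; congr (_ - _)%N.
by apply: eq_card => i; rewrite !inE !ffunE negbK.
Qed.

Lemma patternP (n l : nat) (q p : {ffun 'I_n -> 'I_l}) :
  reflect (exists phi : 'S_l, p = relabel q phi) (p \in pattern q).
Proof.
apply: (iffP orbitP) => [[phi _ <-] | [phi ->]]; first by exists phi.
by exists phi; rewrite ?inE.
Qed.

Lemma pattern_dist_le (n l : nat) (t1 t2 : {set {ffun 'I_n -> 'I_l}})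
    (q p : {ffun 'I_n -> 'I_l}) :
  q \in t1 -> p \in t2 -> (pattern_dist t1 t2 <= hamming q p)%N.
Proof.
move=> qt pt; rewrite /pattern_dist -minEnat -leEnat.
by apply: (@Order.TotalTheory.bigmin_le_cond _ _ _ _ (q, p)); rewrite inE qt.
Qed.

Theorem mainTheorem2 (n l : nat) (hn : (1 <= n)%N) (hl : (1 <= l)%N)
    (q1 q2 : {ffun 'I_n -> 'I_l}) :
  (pattern_dist (pattern q1) (pattern q2))%:Z =
    n%:Z - (\max_(Phi : 'S_l * 'S_l) \tr (Pmx2 Phi *m Amx q1 q2))%N%:Z.
Proof.
set F := fun Phi => \tr (Pmx2 Phi *m Amx q1 q2).
(* This bound makes the integer difference equal to the truncated one. *)
have maxF_le : (\max_Phi F Phi <= n)%N.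
  apply/bigmax_leqP => Phi _; rewrite /F mxtrace_agreement.
  by rewrite (leq_trans (max_card _)) ?card_ord.
rewrite subzn //; congr Posz; apply/eqP; rewrite eqn_leq; apply/andP; split.
  (* A maximizing [Phi] yields a pair of relabelings attaining the value; [(1, 1)] only shows that
     there is some [Phi]. *)
  have [|Phi ->] := @eq_bigmax _ F; first by apply/card_gt0P; exists (1, 1)%g.
  rewrite -hamming_relabel; apply: pattern_dist_le.
    by apply/patternP; exists Phi.1.
  by apply/patternP; exists Phi.2.
(* The lower bound must also hold for the initial value [n] of the minimum. *)
rewrite /pattern_dist; elim/big_rec: _ => [|[q p] m]; first exact: leq_subr.
rewrite inE /= => /andP[/patternP[phi1 ->] /patternP[phi2 ->]] le_m.
rewrite leq_min le_m andbT (@hamming_relabel _ _ _ _ (phi1, phi2)).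
by rewrite leq_sub2l // (leq_bigmax (F := F)).
Qed.
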